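(* Let $X$ be a nonempty set and let $F\colon X^*\to X^*$ be a function such that $F(\varepsilon)=\varepsilon$. The following conditions are equivalent. (i) $F$ is associative, i.e., $F(\mathbf{x}\mathbf{y}\mathbf{z})=F(\mathbf{x}F(\mathbf{y})\mathbf{z})$ for all $\mathbf{x},\mathbf{y},\mathbf{z}\in X^*$. (ii) For any $\mathbf{x},\mathbf{y},\mathbf{z},\mathbf{x}',\mathbf{y}',\mathbf{z}'\in X^*$ such that $\mathbf{x}\mathbf{y}\mathbf{z}=\mathbf{x}'\mathbf{y}'\mathbf{z}'$ we have $F(\mathbf{x}F(\mathbf{y})\mathbf{z})=F(\mathbf{x}'F(\mathbf{y}')\mathbf{z}')$. (iii) For any $\mathbf{x},\mathbf{y},\mathbf{z}\in X^*$ we have $F(F(\mathbf{x}\mathbf{y})\mathbf{z})=F(\mathbf{x}F(\mathbf{y}\mathbf{z}))$. (iv) For any $\mathbf{x},\mathbf{y}\in X^*$ we have $F(\mathbf{x}\mathbf{y})=F(F(\mathbf{x})F(\mathbf{y}))$.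
   Context: $X^*=\bigcup_{n\geq 0}X^n$ is the free monoid of strings over $X$ (concatenation written as juxtaposition), with empty string $\varepsilon$ as neutral element. *)

(* Defs.v *)
From mathcomp Require Export all_boot.

(* X^* is [seq X]: concatenation is [++] and the empty string is [[::]]. *)

Definition assoc_string_fun (X : Type) (F : seq X -> seq X) : Prop :=
  forall x y z : seq X, F (x ++ y ++ z) = F (x ++ F y ++ z).

(* Main.v *)
Require Import Defs.
From mathcomp Require Import all_boot.

(** The conditions are proved in a cycle. Associativity makes [F (x ++ F y ++ z)] depend only on the
    whole string, hence (ii), and (iii) compares two ways of cutting it. The link between (iii),
    (iv) and (i) is that [F] is idempotent, which follows from [hF]. *)

Theorem proposition2p3 (X : Type) (hX : inhabited X) (F : seq X -> seq X)
    (hF : F [::] = [::]) :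
  [<-> assoc_string_fun X F;
       forall x y z x' y' z' : seq X, x ++ y ++ z = x' ++ y' ++ z' ->
         F (x ++ F y ++ z) = F (x' ++ F y' ++ z');
       forall x y z : seq X, F (F (x ++ y) ++ z) = F (x ++ F (y ++ z));
       forall x y : seq X, F (x ++ y) = F (F x ++ F y)].
Proof.
tfae.
- by move=> Fassoc x y z x' y' z' eq_xyz; rewrite -!Fassoc eq_xyz.
- move=> Fdecomp x y z.
  (* One cut has an empty left context, the other an empty right context. *)
  have := Fdecomp [::] (x ++ y) z x (y ++ z) [::].
  by rewrite !cats0 /= -catA; apply.
- move=> Fiii.
  have Fidem x : F (F x) = F x by have := Fiii x [::] [::]; rewrite hF !cats0.
  (* An empty outer string in (iii) leaves [F (F (x ++ y))] on one side, which idempotence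
     collapses; so [F] can be erased on either factor. *)
  have Fl x y : F (F x ++ y) = F (x ++ y) by rewrite (Fiii [::] x y) Fidem.
  have Fr x y : F (x ++ F y) = F (x ++ y).
    by have := Fiii x y [::]; rewrite !cats0 Fidem.
  by move=> x y; rewrite Fl Fr.
- move=> Fmul.
  have Fidem x : F (F x) = F x by have := Fmul [::] x; rewrite hF.
  move=> x y z.
  (* Both sides expand to [F (F x ++ F (F y ++ F z))], once [F (F y)] is reduced on the right. *)
  rewrite (Fmul x (y ++ z)) (Fmul y z).
  by rewrite (Fmul x (F y ++ z)) (Fmul (F y) z) Fidem.
Qed.
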